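(* Let $\mathcal{L}$ be the twisted Heisenberg-Virasoro algebra. Every 2-local derivation on $\mathcal{L}$ is a derivation of $\mathcal{L}$.
   Context: The twisted Heisenberg-Virasoro algebra $\mathcal{L}$ is the complex Lie algebra with basis $\{L_n, I_n, C_L, C_{LI}, C_I \mid n\in\mathbb{Z}\}$ and commutation relations (for $n,m\in\mathbb{Z}$) $[L_n,L_m]=(n-m)L_{n+m}+\delta_{n,-m}\frac{n^3-n}{12}C_L$, $[L_n,I_m]=-mI_{n+m}+\delta_{n,-m}(n^2+n)C_{LI}$, $[I_n,I_m]=n\delta_{n,-m}C_I$, $[\mathcal{L},C_L]=[\mathcal{L},C_{LI}]=[\mathcal{L},C_I]=0$. A derivation of $\mathcal{L}$ is a $\mathbb{C}$-linear map $D:\mathcal{L}\to\mathcal{L}$ with $D([x,y])=[D(x),y]+[x,D(y)]$ for all $x,y\in\mathcal{L}$. A map $\Delta:\mathcal{L}\to\mathcal{L}$ (not necessarily linear) is a 2-local derivation if for every $x,y\in\mathcal{L}$ there exists a derivation $\Delta_{x,y}:\mathcal{L}\to\mathcal{L}$ (depending on $x,y$) such that $\Delta_{x,y}(x)=\Delta(x)$ and $\Delta_{x,y}(y)=\Delta(y)$. *)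

(* Defs.v *)
From HB Require Import structures.
From mathcomp Require Import all_boot all_order all_algebra.
From mathcomp Require Import finmap monalg.
From mathcomp Require Import ring.

Set Implicit Arguments.
Unset Strict Implicit.
Unset Printing Implicit Defensive.

Import GRing.Theory Num.Theory.

Local Open Scope ring_scope.

Inductive thv_index : Type :=
  | iL of int | iI of int | iCL | iCLI | iCI.

Definition thv_index_code (k : thv_index) : int + (int + 'I_3) :=
  match k with
  | iL n => inl n
  | iI n => inr (inl n)
  | iCL => inr (inr (inord 0))
  | iCLI => inr (inr (inord 1))
  | iCI => inr (inr (inord 2))
  end.

Definition thv_index_decode (c : int + (int + 'I_3)) : thv_index :=
  match c with
  | inl n => iL n
  | inr (inl n) => iI n
  | inr (inr j) => if val j == 0%N then iCL else if val j == 1%N then iCLI else iCI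
  end.

Lemma thv_index_codeK : cancel thv_index_code thv_index_decode.
Proof. by case=> //=; rewrite inordK. Qed.

HB.instance Definition _ := Choice.copy thv_index (can_type thv_index_codeK).

Section TwistedHeisenbergVirasoro.

Variable F : numFieldType.

(* Over a general F only because unification in {malg _[_]} is much faster for an
   abstract field; the algebra of interest is the complex one, F = R[i]. *)
Definition thv : Type := {malg F[thv_index]}.

HB.instance Definition _ := GRing.Lmodule.on thv.

Definition thv_basis (k : thv_index) : thv := mkmalgU k 1.

Local Notation L n := (thv_basis (iL n)).
Local Notation I n := (thv_basis (iI n)).
Local Notation C_L := (thv_basis iCL).
Local Notation C_LI := (thv_basis iCLI).
Local Notation C_I := (thv_basis iCI).

Definition thv_bracketLI (n m : int) : thv :=
  (- m%:~R) *: I (n + m) + (n == - m)%:R *: ((n ^+ 2 + n)%:~R *: C_LI).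

Definition thv_bracket_basis (j k : thv_index) : thv :=
  match j, k with
  | iL n, iL m => (n - m)%:~R *: L (n + m)
                  + (n == - m)%:R *: (((n ^+ 3 - n)%:~R / 12%:R) *: C_L)
  | iL n, iI m => thv_bracketLI n m
  | iI n, iL m => - thv_bracketLI m n
  | iI n, iI m => (n == - m)%:R *: (n%:~R *: C_I)
  | _, _ => 0
  end.

Definition thv_bracket (x y : thv) : thv :=
  \sum_(j <- msupp x) \sum_(k <- msupp y)
     (mcoeff j x * mcoeff k y) *: thv_bracket_basis j k.

Definition thv_derivation (D : thv -> thv) : Prop :=
  linear D /\
  forall x y : thv,
    D (thv_bracket x y) = thv_bracket (D x) y + thv_bracket x (D y).

Definition thv_2local_derivation (Delta : thv -> thv) : Prop :=
  forall x y : thv, exists D : thv -> thv,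
    [/\ thv_derivation D, D x = Delta x & D y = Delta y].

Lemma thv_bracketEw (A B : {fset thv_index}) (x y : thv) :
  (msupp x `<=` A)%fset -> (msupp y `<=` B)%fset ->
  thv_bracket x y = \sum_(j <- A) \sum_(k <- B)
     (mcoeff j x * mcoeff k y) *: thv_bracket_basis j k.
Proof.
move=> sA sB; rewrite /thv_bracket (big_fset_incl _ sA) /=; last first.
  by move=> j _ jx; rewrite big1 // => k _; rewrite (mcoeff_outdom jx) mul0r scale0r.
apply: eq_bigr => j _; rewrite (big_fset_incl _ sB) //.
by move=> k _ ky; rewrite (mcoeff_outdom ky) mulr0 scale0r.
Qed.

Lemma thv_bracket_basisE (j k : thv_index) :
  thv_bracket (thv_basis j) (thv_basis k) = thv_bracket_basis j k.
Proof.
by rewrite (thv_bracketEw msuppU_le msuppU_le) !big_seq_fset1 !mcoeffUU mulr1 scale1r.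
Qed.

Lemma thv_bracket_linearl (y : thv) : linear (thv_bracket^~ y).
Proof.
move=> a x x' /=; set A := (msupp x `|` msupp x')%fset.
have sA : (msupp x `<=` A)%fset by exact: fsubsetUl.
have sA' : (msupp x' `<=` A)%fset by exact: fsubsetUr.
have sAA : (msupp (a *: x + x') `<=` A)%fset.
  apply: (fsubset_trans (msuppD_le _ _)); apply: fsetSU; exact: msuppZ_le.
rewrite (thv_bracketEw sA (fsubset_refl _)) (thv_bracketEw sA' (fsubset_refl _)).
rewrite (thv_bracketEw sAA (fsubset_refl _)) scaler_sumr -big_split /=.
apply: eq_bigr => j _; rewrite scaler_sumr -big_split /=; apply: eq_bigr => k _.
by rewrite mcoeffD mcoeffZ scalerA -scalerDl mulrDl mulrA.
Qed.

Lemma thv_bracket_linearr (x : thv) : linear (thv_bracket x).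
Proof.
move=> a y y' /=; set A := (msupp y `|` msupp y')%fset.
have sA : (msupp y `<=` A)%fset by exact: fsubsetUl.
have sA' : (msupp y' `<=` A)%fset by exact: fsubsetUr.
have sAA : (msupp (a *: y + y') `<=` A)%fset.
  apply: (fsubset_trans (msuppD_le _ _)); apply: fsetSU; exact: msuppZ_le.
rewrite (thv_bracketEw (fsubset_refl _) sA) (thv_bracketEw (fsubset_refl _) sA').
rewrite (thv_bracketEw (fsubset_refl _) sAA) scaler_sumr -big_split /=.
apply: eq_bigr => j _; rewrite scaler_sumr -big_split /=; apply: eq_bigr => k _.
by rewrite mcoeffD mcoeffZ scalerA -scalerDl mulrDr mulrCA.
Qed.

Lemma thv_basisE (x : thv) :
  x = \sum_(k <- msupp x) mcoeff k x *: thv_basis k.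
Proof.
rewrite [LHS]monalgE; apply: eq_bigr => k _; apply/malgP => l.
by rewrite mcoeffZ !mcoeffU mulrnAr mulr1.
Qed.

Lemma thv_linear_ext (V : lmodType F) (f g : thv -> V) :
  linear f -> linear g -> (forall k, f (thv_basis k) = g (thv_basis k)) ->
  forall x, f x = g x.
Proof.
move=> lf lg fg x.
pose f1 : {linear thv -> V} := HB.pack f (GRing.isLinear.Build F thv V *:%R f lf).
pose g1 : {linear thv -> V} := HB.pack g (GRing.isLinear.Build F thv V *:%R g lg).
rewrite -[f x]/(f1 x) -[g x]/(g1 x) (thv_basisE x) !linear_sum /=.
by apply: eq_bigr => k _; rewrite -[f _]/(f1 _) -[g _]/(g1 _) !linearZ_LR /= fg.
Qed.

Lemma thv_bracketC (x y : thv) : thv_bracket x y = - thv_bracket y x.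
Proof.
move: x; apply: thv_linear_ext; first exact: thv_bracket_linearl.
  by move=> a u v; rewrite thv_bracket_linearr opprD scalerN.
move=> j; move: y; apply: thv_linear_ext; first exact: thv_bracket_linearr.
  by move=> a u v; rewrite thv_bracket_linearl opprD scalerN.
move=> k; rewrite !thv_bracket_basisE; case: j k => [n|n|||] [m|m|||] //=;
  rewrite ?oppr0 ?opprK // [m == _]eq_sym eqr_oppLR ?(congr1 iL (addrC m n));
  apply/malgP => l; rewrite !(mcoeffD, mcoeffN, mcoeffZ).
- move: (mcoeff _ _) (mcoeff _ _) => a b.
  by case: eqP => [->|_]; rewrite /=; ring.
- move: (mcoeff _ _) => a.
  by case: eqP => [->|_]; rewrite /=; ring.
Qed.

Lemma thv_bracketxx (x : thv) : thv_bracket x x = 0.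
Proof.
have /eqP := thv_bracketC x x; rewrite -addr_eq0 -mulr2n -scaler_nat scaler_eq0.
rewrite pnatr_eq0 [_ || _]/= => /eqP; exact: id.
Qed.

Lemma thv_bracketDr (x y z : thv) :
  thv_bracket x (y + z) = thv_bracket x y + thv_bracket x z.
Proof. by have := thv_bracket_linearr x 1 y z; rewrite !scale1r. Qed.

Lemma thv_bracketr0 (x : thv) : thv_bracket x 0 = 0.
Proof.
by apply: (addrI (thv_bracket x 0)); rewrite -thv_bracketDr !addr0.
Qed.

Lemma thv_bracketZr (a : F) (x y : thv) :
  thv_bracket x (a *: y) = a *: thv_bracket x y.
Proof. by have := thv_bracket_linearr x a y 0; rewrite !addr0 thv_bracketr0 addr0. Qed.

Lemma thv_bracketNr (x y : thv) : thv_bracket x (- y) = - thv_bracket x y.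
Proof. by rewrite -scaleN1r thv_bracketZr scaleN1r. Qed.

Lemma thv_bracketZl (a : F) (x y : thv) :
  thv_bracket (a *: x) y = a *: thv_bracket x y.
Proof. by rewrite [LHS]thv_bracketC thv_bracketZr -scalerN -thv_bracketC. Qed.

Lemma thv_bracketDl (x y z : thv) :
  thv_bracket (x + y) z = thv_bracket x z + thv_bracket y z.
Proof. by rewrite [LHS]thv_bracketC thv_bracketDr opprD -!thv_bracketC. Qed.

Lemma thv_jacobi_basis (V : lmodType F) (e : thv_index -> V) (b : V -> V -> V) :
  (forall x, b x 0 = 0) -> (forall x y z, b x (y + z) = b x y + b x z) ->
  (forall a x y, b x (a *: y) = a *: b x y) ->
  (forall x y, b x y = - b y x) ->
  (forall n m, b (e (iL n)) (e (iL m)) = (n - m)%:~R *: e (iL (n + m))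
     + (n == - m)%:R *: (((n ^+ 3 - n)%:~R / 12%:R) *: e iCL)) ->
  (forall n m, b (e (iL n)) (e (iI m)) = (- m%:~R) *: e (iI (n + m))
     + (n == - m)%:R *: ((n ^+ 2 + n)%:~R *: e iCLI)) ->
  (forall n m, b (e (iI n)) (e (iI m)) = (n == - m)%:R *: (n%:~R *: e iCI)) ->
  (forall x, b x (e iCL) = 0) -> (forall x, b x (e iCLI) = 0) ->
  (forall x, b x (e iCI) = 0) ->
  forall j k l, b (e j) (b (e k) (e l)) + b (e k) (b (e l) (e j))
    + b (e l) (b (e j) (e k)) = 0.
Proof.
move=> b0 bD bZ bC LL LI II c1 c2 c3.
have bN x y : b x (- y) = - b x y by rewrite -scaleN1r bZ scaleN1r.
have IL n m : b (e (iI n)) (e (iL m)) = - b (e (iL m)) (e (iI n)) by [].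
have c1' x : b (e iCL) x = 0 by rewrite bC c1 oppr0.
have c2' x : b (e iCLI) x = 0 by rewrite bC c2 oppr0.
have c3' x : b (e iCI) x = 0 by rewrite bC c3 oppr0.
clear bC.
have S (n m p : int) : (n == - (m + p)) = (n + m + p == 0).
  by rewrite -addr_eq0 addrA.
have rot (n m p : int) : n + m + p = m + p + n by ring.
have swap (n m p : int) : m + n + p = n + m + p by ring.
have AC (x1 x2 x3 y1 y2 y3 : V) :
    x1 + y1 + (x2 + y2) + (x3 + y3) = x1 + x2 + x3 + (y1 + y2 + y3).
  by rewrite (addrACA x1 y1) (addrACA (x1 + x2)).
have comb (d a1 a2 a3 b1 b2 b3 f1 f2 f3 : F) (u v : V) :
    a1 * b1 + a2 * b2 + a3 * b3 = 0 -> d * (a1 * f1 + a2 * f2 + a3 * f3) = 0 ->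
  a1 *: (b1 *: v + d *: (f1 *: u)) + a2 *: (b2 *: v + d *: (f2 *: u))
    + a3 *: (b3 *: v + d *: (f3 *: u)) = 0.
  move=> E1 E2.
  transitivity ((a1 * b1 + a2 * b2 + a3 * b3) *: v
                + (a1 * (d * f1) + a2 * (d * f2) + a3 * (d * f3)) *: u).
    by rewrite !scalerDr !scalerDl !scalerA !mulrA AC.
  rewrite E1 scale0r add0r (_ : _ + _ = 0) ?scale0r // -[RHS]E2; ring.
have LLL n m p : b (e (iL n)) (b (e (iL m)) (e (iL p)))
  + b (e (iL m)) (b (e (iL p)) (e (iL n)))
  + b (e (iL p)) (b (e (iL n)) (e (iL m))) = 0.
  rewrite !(LL, bD, bZ, c1, scaler0, addr0) !S !addrA.
  rewrite -(rot n m p) (rot p n m); apply: comb; first by ring.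
  by case: eqP => [/addr0_eq <-|_] /=; ring.
have LLI n m p : b (e (iL n)) (b (e (iL m)) (e (iI p)))
  + b (e (iL m)) (b (e (iI p)) (e (iL n)))
  + b (e (iI p)) (b (e (iL n)) (e (iL m))) = 0.
  rewrite !(IL, bN, LI, LL, bD, bZ, c1, c2, scaler0, addr0).
  rewrite scalerN -!scaleNr !S -(addr_eq0 (n + m)) !addrA (swap n m p).
  apply: comb; first by ring.
  by case: eqP => [/addr0_eq <-|_] /=; ring.
have LII n m p : b (e (iL n)) (b (e (iI m)) (e (iI p)))
  + b (e (iI m)) (b (e (iI p)) (e (iL n)))
  + b (e (iI p)) (b (e (iL n)) (e (iI m))) = 0.
  rewrite !(IL, bN, LI, II, bD, bZ, c2, c3, scaler0, addr0, add0r) -!scaleNr !S.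
  rewrite (rot p n m) (swap n m p) !scalerA -scalerDl (_ : _ + _ = 0) ?scale0r //.
  by ring.
have cyc j k l : b (e j) (b (e k) (e l)) + b (e k) (b (e l) (e j))
      + b (e l) (b (e j) (e k)) = 0 ->
    b (e k) (b (e l) (e j)) + b (e l) (b (e j) (e k)) + b (e j) (b (e k) (e l)) = 0.
  by rewrite -addrA addrC.
have central (c : V) : (forall x, b x c = 0) -> (forall x, b c x = 0) ->
  forall x y, b x (b y c) + b y (b c x) + b c (b x y) = 0.
  by move=> bc cb x y; rewrite cb bc !cb !b0 !addr0.
have {central} cen j k l : (forall x, b x (e l) = 0) -> (forall x, b (e l) x = 0) ->
  b (e j) (b (e k) (e l)) + b (e k) (b (e l) (e j)) + b (e l) (b (e j) (e k)) = 0.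
  by move=> *; apply: central.
have III n m p : b (e (iI n)) (b (e (iI m)) (e (iI p)))
  + b (e (iI m)) (b (e (iI p)) (e (iI n)))
  + b (e (iI p)) (b (e (iI n)) (e (iI m))) = 0.
  by rewrite !(II, bZ, c3, scaler0, addr0).
move=> j k l.
case: l => [p|p|||]; try by apply: cen.
all: case: k => [m|m|||]; try by apply/cyc/cen.
all: case: j => [n|n|||]; try by apply/cyc/cyc/cen.
all: try first [exact: LLL | exact: LLI | exact: LII | exact: III].
all: try (apply/cyc; first [exact: LLI | exact: LII]).
all: try (apply/cyc/cyc; first [exact: LLI | exact: LII]).
Qed.

Lemma thv_jacobi (x y z : thv) :
  thv_bracket x (thv_bracket y z) + thv_bracket y (thv_bracket z x)
    + thv_bracket z (thv_bracket x y) = 0.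
Proof.
have lin0 : linear (fun _ : thv => 0 : thv) by move=> a u v; rewrite scaler0 addr0.
have lin3 (V : lmodType F) (a : F) (p q r p' q' r' : V) :
  (a *: p + p') + (a *: q + q') + (a *: r + r') = a *: (p + q + r) + (p' + q' + r').
  by rewrite !scalerDr (addrACA (a *: p)) [LHS]addrACA.
move: x; apply: thv_linear_ext => // [a u v|j].
  rewrite !(thv_bracketDl, thv_bracketDr, thv_bracketZl, thv_bracketZr); exact: lin3.
move: y; apply: thv_linear_ext => // [a u v|k].
  rewrite !(thv_bracketDl, thv_bracketDr, thv_bracketZl, thv_bracketZr); exact: lin3.
move: z; apply: thv_linear_ext => // [a u v|l].
  rewrite !(thv_bracketDl, thv_bracketDr, thv_bracketZl, thv_bracketZr); exact: lin3.
have central c : (forall k, thv_bracket_basis k c = 0) ->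
    forall x, thv_bracket x (thv_basis c) = 0.
  move=> kc; apply: thv_linear_ext => // [|k']; first exact: thv_bracket_linearl.
  by rewrite thv_bracket_basisE.
move: j k l; apply: thv_jacobi_basis.
- exact: thv_bracketr0.
- exact: thv_bracketDr.
- exact: thv_bracketZr.
- exact: thv_bracketC.
- by move=> n m; exact: thv_bracket_basisE.
- by move=> n m; exact: thv_bracket_basisE.
- by move=> n m; exact: thv_bracket_basisE.
- by apply: central; case.
- by apply: central; case.
- by apply: central; case.
Qed.

End TwistedHeisenbergVirasoro.

(* Main.v *)
(* Grade L by deg L_n = deg I_n = n.  Subtracting an inner derivation from a
   derivation D one may assume that D preserves the degree, and the brackets in
   nonzero degrees then give, for some u and scalars al, be, ga and all n != 0,
     D L_n = [u, L_n] + (al + be n) I_n   and   D I_n = [u, I_n] + ga I_n.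
   For the probe z_p = L_p - L_(p+2) + I_(p+1), p > 0, it follows that D z_p = 0
   forces D = c ad z_p for a scalar c.  Given a 2-local Delta, pick a derivation D
   agreeing with it at z_1 and z_2.  Then Delta z_N - D z_N is a multiple of both
   [z_1, z_N] and [z_2, z_N], hence 0 for N > 2 by comparing leading terms; and for
   any x, Delta x - D x is a multiple of both [z_1, x] and [z_N, x], whose supports
   lie in disjoint degrees when N is large, so Delta = D. *)

Require Import Defs.
From mathcomp Require Import all_boot all_order all_algebra.
From mathcomp Require Import reals complex.
From mathcomp Require Import finmap monalg ring zify.

Set Implicit Arguments.
Unset Strict Implicit.
Unset Printing Implicit Defensive.

Import Order.TTheory GRing.Theory Num.Theory.

Local Open Scope ring_scope.

Section TwistedHeisenbergVirasoro.

Variable F : numFieldType.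

Local Notation e := (thv_basis F).
Local Notation "{[ x , y ]}" := (thv_bracket x y) (at level 0).

Implicit Types (x y z u v : thv F) (i j k : thv_index) (n m p : int).

(** * Degrees and coefficients *)

(** The eigenvalue of [[-, L_0]] on the basis vector, see [thv_coef_bracketL0]. *)
Definition thv_degree k : int :=
  match k with iL n | iI n => n | _ => 0 end.

(* [mcoeff] with [thv F] as its domain: rewriting with [mcoeffD] and the like
   makes unification unfold [thv] and the hierarchy below it. *)
Definition thv_coef k x : F := mcoeff k x.

Lemma thv_coefD k x y : thv_coef k (x + y) = thv_coef k x + thv_coef k y.
Proof. exact: mcoeffD. Qed.

Lemma thv_coefZ k (a : F) x : thv_coef k (a *: x) = a * thv_coef k x.
Proof. exact: mcoeffZ. Qed.

Lemma thv_coefN k x : thv_coef k (- x) = - thv_coef k x.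
Proof. exact: mcoeffN. Qed.

Lemma thv_coef0 k : thv_coef k 0 = 0.
Proof. exact: mcoeff0. Qed.

Lemma thv_coef_basis j k : thv_coef k (e j) = (j == k)%:R.
Proof. exact: mcoeffU. Qed.

Definition thv_coefE :=
  (thv_coefD, thv_coefZ, thv_coefN, thv_coef0, thv_coef_basis).

Lemma thv_coefP x y : (forall k, thv_coef k x = thv_coef k y) -> x = y.
Proof. by move=> xy; apply/malgP. Qed.

Lemma thv_coef_ext k (f : thv F -> thv F) (g : thv F -> F) :
  linear f -> linear (g : _ -> F^o) ->
  (forall i, thv_coef k (f (e i)) = g (e i)) ->
  forall x, thv_coef k (f x) = g x.
Proof.
move=> lf lg; apply: (@thv_linear_ext _ F^o (fun x => thv_coef k (f x)) g) => //.
by move=> a x y; rewrite lf thv_coefD thv_coefZ.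
Qed.

Lemma thv_coef_scale_linear k (a : F) : linear (fun x => a * thv_coef k x : F^o).
Proof. by move=> b x y; rewrite !thv_coefE mulrDr mulrCA. Qed.

Lemma thv_index_eqE n m :
  ((iL n == iL m) = (n == m)) * ((iI n == iI m) = (n == m)) *
  ((iL n == iI m) = false) * ((iI n == iL m) = false) *
  ((iCL == iL n) = false) * ((iCLI == iL n) = false) * ((iCI == iL n) = false) *
  ((iCL == iI n) = false) * ((iCLI == iI n) = false) * ((iCI == iI n) = false).
Proof. by do !split; apply/eqP/idP => [[] // /eqP|// /eqP ->]. Qed.

(** * Coefficients of brackets *)

(** The bracket is graded: a central term appears only when [n + m = 0], which is the degree given
    to the central generators. *)
Lemma thv_bracket_basis_degree i j k :
  thv_degree k != thv_degree i + thv_degree j ->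
  thv_coef k (thv_bracket_basis F i j) = 0.
Proof.
have N0 (a b : thv_index) : thv_degree a != thv_degree b -> a == b = false.
  by apply: contraNF => /eqP ->.
have central n m (a : F) c :
    thv_degree k != n + m -> thv_degree c = 0 ->
  thv_coef k ((n == - m)%:R *: (a *: e c)) = 0.
  move=> knm c0; rewrite !thv_coefE; case: (eqVneq n) => [nm|]; last first.
    by rewrite mul0r.
  by rewrite (N0 c) ?mulr0 // eq_sym c0; move: knm; rewrite nm addNr.
have bLI n m : thv_degree k != n + m -> thv_coef k (thv_bracketLI F n m) = 0.
  move=> knm; rewrite /thv_bracketLI thv_coefD central // addr0.
  by rewrite thv_coefZ thv_coef_basis (N0 (iI _)) ?mulr0 // eq_sym.
case: i j => [n|n|||] [m|m|||]; try by move=> _; exact: thv_coef0.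
- move=> /= knm; rewrite thv_coefD central // addr0 thv_coefZ thv_coef_basis.
  by rewrite (N0 (iL _)) ?mulr0 // eq_sym.
- by move=> /= knm; apply: bLI.
- by move=> /= knm; rewrite thv_coefN bLI ?oppr0 // addrC.
by move=> /= knm; apply: central.
Qed.

Lemma thv_bracket_degree x y k :
  (forall i j, thv_coef i x != 0 -> thv_coef j y != 0 ->
     thv_degree k != thv_degree i + thv_degree j) ->
  thv_coef k {[x, y]} = 0.
Proof.
have sumE (I : Type) (r : seq I) (f : I -> thv F) :
    thv_coef k (\sum_(i <- r) f i) = \sum_(i <- r) thv_coef k (f i).
  by apply: (big_morph _ (thv_coefD k) (thv_coef0 k)).
move=> H; rewrite /thv_bracket sumE big_seq big1 // => i xi.
rewrite sumE big_seq big1 // => j yj.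
by rewrite thv_coefZ thv_bracket_basis_degree ?mulr0 // H // /thv_coef mcoeff_neq0.
Qed.

Lemma thv_coef_bracketLL x n (k : int) :
  thv_coef (iL k) {[x, e (iL n)]} = (k - n - n)%:~R * thv_coef (iL (k - n)) x.
Proof.
move: x; apply: thv_coef_ext; first exact: thv_bracket_linearl.
  exact: thv_coef_scale_linear.
have eqD (m : int) : (m + n == k) = (m == k - n) by rewrite -[RHS]subr_eq opprK.
move=> i; rewrite thv_bracket_basisE; case: i => [m|m|||] /=;
  rewrite /thv_bracketLI !thv_coefE ?thv_index_eqE ?(mulr0, addr0, oppr0) //
    ?[n + m]addrC ?eqD;
  by case: eqP => [->|_]; rewrite ?mulr0 ?oppr0 // mulr1 ?mulr1 ?rmorphN ?opprK.
Qed.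

Lemma thv_coef_bracketIL x n (k : int) :
  thv_coef (iI k) {[x, e (iL n)]} = (k - n)%:~R * thv_coef (iI (k - n)) x.
Proof.
move: x; apply: thv_coef_ext; first exact: thv_bracket_linearl.
  exact: thv_coef_scale_linear.
have eqD (m : int) : (m + n == k) = (m == k - n) by rewrite -[RHS]subr_eq opprK.
move=> i; rewrite thv_bracket_basisE; case: i => [m|m|||] /=;
  rewrite /thv_bracketLI !thv_coefE ?thv_index_eqE ?(mulr0, addr0, oppr0) //
    ?[n + m]addrC ?eqD;
  by case: eqP => [->|_]; rewrite ?mulr0 ?oppr0 // mulr1 ?mulr1 ?rmorphN ?opprK.
Qed.

Lemma thv_coef_bracketII x n (k : int) :
  thv_coef (iI k) {[x, e (iI n)]} = (- n)%:~R * thv_coef (iL (k - n)) x.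
Proof.
move: x; apply: thv_coef_ext; first exact: thv_bracket_linearl.
  exact: thv_coef_scale_linear.
have eqD (m : int) : (m + n == k) = (m == k - n) by rewrite -[RHS]subr_eq opprK.
move=> i; rewrite thv_bracket_basisE; case: i => [m|m|||] /=;
  rewrite /thv_bracketLI !thv_coefE ?thv_index_eqE ?(mulr0, addr0, oppr0) //
    ?[n + m]addrC ?eqD;
  by rewrite rmorphN.
Qed.

Lemma thv_coef_bracketLI x n (k : int) : thv_coef (iL k) {[x, e (iI n)]} = 0.
Proof.
move: x; apply: thv_coef_ext; first exact: thv_bracket_linearl.
  by move=> a u v; rewrite scaler0 addr0.
move=> i; rewrite thv_bracket_basisE; case: i => [m|m|||] /=;
  by rewrite /thv_bracketLI !thv_coefE ?thv_index_eqE ?(mulr0, addr0, oppr0).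
Qed.

(** Bracketing with [L_0] is diagonal because its cocycle terms vanish: both [n^3 - n] and [n^2 + n]
    are zero at [n = 0]. *)
Lemma thv_coef_bracketL0 x k :
  thv_coef k {[x, e (iL 0)]} = (thv_degree k)%:~R * thv_coef k x.
Proof.
move: x; apply: thv_coef_ext; first exact: thv_bracket_linearl.
  exact: thv_coef_scale_linear.
move=> i; rewrite thv_bracket_basisE thv_coef_basis.
have [->|ik] := eqVneq i k.
  case: k => [m|m|||] /=; rewrite /thv_bracketLI !thv_coefE
    ?addr0 ?add0r ?subr0 ?eqxx ?mulr0 ?mulr1 ?addr0 ?opprK ?mul0r //.
rewrite mulr0; case: i ik => [m|m|||] /=; rewrite ?thv_coef0 // => ik.
- rewrite !thv_coefE oppr0 addr0 (negPf ik) mulr0 add0r.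
  by case: eqP => [->|_]; rewrite ?mul0r ?expr0n ?subr0 ?mul0r ?mulr0.
rewrite /thv_bracketLI !thv_coefE add0r (negPf ik).
by rewrite expr0n addr0 mul0r !mulr0 addr0 oppr0.
Qed.

#[local] Opaque thv_basis thv_bracket.

(** * Central elements *)

(** [I_0] joins the three central generators: every coefficient of [[L_n, I_0]] and [[I_n, I_0]]
    carries a factor that is zero, or a delta forcing [n = 0] and then a zero factor. *)
Lemma thv_bracket_central x k :
  match k with iL _ => false | iI n => n == 0 | _ => true end ->
  {[x, e k]} = 0.
Proof.
move=> kc; move: x; apply: thv_linear_ext; first exact: thv_bracket_linearl.
  by move=> a u v; rewrite scaler0 addr0.
move=> j; rewrite thv_bracket_basisE.
case: k j kc => [//|n|||] [m|m|||] //= => [/eqP->|/eqP->].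
  rewrite /thv_bracketLI oppr0 scale0r add0r.
  by case: eqP => [->|_]; rewrite ?expr0n ?scale0r ?scaler0.
by rewrite oppr0; case: eqP => [->|_]; rewrite ?scale0r ?scaler0.
Qed.

Lemma thv_bracket_centralr x c :
  (forall n, thv_coef (iL n) c = 0) ->
  (forall n, n != 0 -> thv_coef (iI n) c = 0) -> {[x, c]} = 0.
Proof.
move=> cL cI; rewrite (thv_basisE c).
rewrite (big_morph _ (thv_bracketDr x) (thv_bracketr0 x)) big1 // => k _.
rewrite thv_bracketZr -/(thv_coef k c).
case: k => [n|n|||]; last by rewrite thv_bracket_central ?scaler0.
- by rewrite cL scale0r.
- have [n0|n0] := eqVneq n 0; last by rewrite cI ?scale0r.
  by rewrite thv_bracket_central ?scaler0 ?n0.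
- by rewrite thv_bracket_central ?scaler0.
- by rewrite thv_bracket_central ?scaler0.
Qed.

(** * Basic properties of derivations *)

Lemma thv_derivationD D x y : thv_derivation D -> D (x + y) = D x + D y :> thv F.
Proof. by case=> lD _; have := lD 1 x y; rewrite !scale1r. Qed.

Lemma thv_derivation0 D : thv_derivation D -> D 0 = 0 :> thv F.
Proof. by move=> dD; apply: (addrI (D 0)); rewrite -(thv_derivationD _ _ dD) !addr0. Qed.

Lemma thv_derivationZ D (a : F) x : thv_derivation D -> D (a *: x) = a *: D x.
Proof.
by move=> dD; case: (dD) => lD _; have := lD a x 0; rewrite (thv_derivation0 dD) !addr0.
Qed.

Lemma thv_derivation_comb D (a b : F) x y : thv_derivation D ->
  D (a *: x + b *: y) = a *: D x + b *: D y.
Proof.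
by move=> dD; rewrite (thv_derivationD _ _ dD) !(thv_derivationZ _ _ dD).
Qed.

Lemma thv_derivation_ad u : thv_derivation (thv_bracket u).
Proof.
split=> [|x y]; first exact: thv_bracket_linearr.
have /eqP := thv_jacobi u x y; rewrite -addrA addr_eq0 => /eqP ->.
by rewrite (thv_bracketC y u) thv_bracketNr (thv_bracketC y) opprD !opprK addrC.
Qed.

Lemma thv_derivationB D D' : thv_derivation D -> thv_derivation D' ->
  thv_derivation (fun x => D x - D' x : thv F).
Proof.
move=> dD dD'; split=> [a x y|x y].
  rewrite (thv_derivationD _ _ dD) (thv_derivationD _ _ dD').
  by rewrite (thv_derivationZ _ _ dD) (thv_derivationZ _ _ dD') scalerBr opprD addrACA.
case: dD dD' => _ -> [_ ->].
rewrite thv_bracketDl thv_bracketDr thv_bracketNr -[- D' x]scaleN1r.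
by rewrite thv_bracketZl scaleN1r opprD addrACA.
Qed.

(** The basis vectors of nonzero degree generate the algebra. [[L_n, L_(-n)]] yields [L_0] at
    [n = 1], where the cocycle vanishes, and then [C_L] at [n = 2]; [[L_n, I_(-n)]] yields [I_0] at
    [n = -1] and then [C_LI] at [n = 1]; [[I_1, I_(-1)]] is [C_I]. *)
Lemma thv_derivation_eq0 D : thv_derivation D ->
  (forall n, n != 0 -> D (e (iL n)) = 0) ->
  (forall n, n != 0 -> D (e (iI n)) = 0) -> forall x, D x = 0.
Proof.
move=> dD DL DI.
have Dbr (j k : thv_index) : D (e j) = 0 -> D (e k) = 0 ->
    D (thv_bracket_basis F j k) = 0.
  move=> Dj Dk; case: (dD) => _ DM; rewrite -thv_bracket_basisE DM Dj Dk.
  by rewrite thv_bracketr0 thv_bracketC thv_bracketr0 oppr0 addr0.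
have LL n : n != 0 ->
    (n + n)%:~R *: D (e (iL 0)) + ((n ^+ 3 - n)%:~R / 12%:R) *: D (e iCL) = 0.
  move=> n0; have nn0 : - n != 0 by rewrite oppr_eq0.
  have := Dbr _ _ (DL n n0) (DL _ nn0); rewrite /= subrr opprK eqxx scale1r.
  by rewrite thv_derivation_comb.
have LI n : n != 0 ->
    n%:~R *: D (e (iI 0)) + (n ^+ 2 + n)%:~R *: D (e iCLI) = 0.
  move=> n0; have nn0 : - n != 0 by rewrite oppr_eq0.
  have := Dbr _ _ (DL n n0) (DI _ nn0); rewrite /= /thv_bracketLI subrr opprK.
  rewrite eqxx scale1r mulrNz opprK.
  by rewrite thv_derivation_comb.
have ZI (a : F) x : a != 0 -> a *: x = 0 -> x = 0.
  by move=> a0 /eqP; rewrite scaler_eq0 (negPf a0) => /eqP.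
have ZI2 (a b : F) x y : a *: x + b *: y = 0 -> x = 0 -> b != 0 -> y = 0.
  by move=> xy x0 /ZI; apply; rewrite -xy x0 scaler0 add0r.
have L0 : D (e (iL 0)) = 0.
  apply: (ZI 2%:R); first by rewrite pnatr_eq0.
  by have := LL 1 isT; rewrite expr1n subrr mul0r scale0r addr0.
have CL : D (e iCL) = 0.
  apply: (ZI2 _ _ _ _ (LL 2 isT) L0).
  by rewrite mulf_neq0 ?invr_eq0 ?pnatr_eq0 // intr_eq0.
have I0 : D (e (iI 0)) = 0.
  have := LI (- 1) isT; rewrite sqrrN expr1n subrr scale0r addr0; apply: ZI.
  by rewrite intr_eq0.
have CLI : D (e iCLI) = 0.
  by apply: (ZI2 _ _ _ _ (LI 1 isT) I0); rewrite intr_eq0.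
have CI : D (e iCI) = 0.
  have := Dbr _ _ (DI 1 isT) (DI (- 1) isT); rewrite /= scale1r.
  by rewrite (thv_derivationZ _ _ dD) scale1r.
apply: (@thv_linear_ext _ _ D (fun=> 0)); first by case: dD.
  by move=> a u v; rewrite scaler0 addr0.
case=> [n|n|||]; [| |exact: CL|exact: CLI|exact: CI].
- by have [->|] := eqVneq n 0; [exact: L0|exact: DL].
- by have [->|] := eqVneq n 0; [exact: I0|exact: DI].
Qed.

(** * Functional equations on nonzero integers *)

(** Adding 1 repeatedly makes [h] constant from 2 on. The case [n = m] is void, so [h 2] is not
    reached from [1 + 1]; it vanishes because [2 + 3 = 5] gives [h 2 = h 2 + h 2]. Negative [n]
    follow from [n + (1 - n) = 1]. *)
Lemma add_constant_vanish (h : int -> F) :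
  (forall n m, n != 0 -> m != 0 -> n + m != 0 ->
     (n - m)%:~R * h (n + m) = (n - m)%:~R * (h n + h m)) ->
  h 1 = 0 -> forall n, n != 0 -> h n = 0.
Proof.
move=> H h1.
have hD n m : n != 0 -> m != 0 -> n + m != 0 -> n != m -> h (n + m) = h n + h m.
  move=> n0 m0 nm0 nm; apply: (@mulfI _ (n - m)%:~R); last exact: H.
  by rewrite intr_eq0 subr_eq0.
have hS (k : nat) : h (k%:Z + 2) = h 2.
  elim: k => [|k IHk]; first by rewrite add0r.
  rewrite (_ : k.+1%:Z + 2 = (k%:Z + 2) + 1); last lia.
  by rewrite hD ?IHk ?h1 ?addr0 //; lia.
have h2 : h 2 = 0.
  have := hD 2 3 isT isT isT isT.
  rewrite (hS 3%N : h (2 + 3) = _) (hS 1%N : h 3 = _) => /eqP.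
  by rewrite -subr_eq subrr eq_sym => /eqP.
have pos n : 0 < n -> h n = 0.
  move=> n0; have [->//|n1] := eqVneq n 1.
  by rewrite (_ : n = `|n - 2|%N%:Z + 2) ?hS //; lia.
move=> n n0; have [/pos//|n_le0] := ltP 0 n.
have := hD n (1 - n) n0 ltac:(lia) ltac:(lia) ltac:(lia).
by rewrite (_ : n + (1 - n) = 1) ?(pos (1 - n)) ?addr0 ?h1 //; lia.
Qed.

(** Affine functions solve this equation, and the values at 1 and 2 determine a solution: [m = 1] is
    a recursion whose leading factor [n - 1] is nonzero from [n = 2] on, and [m = 1 - n] reaches
    negative [n]. *)
Lemma cocycle_vanish (h : int -> F) :
  (forall n m, n != 0 -> m != 0 -> n + m != 0 ->
     (n - m)%:~R * h (n + m) = n%:~R * h n - m%:~R * h m) ->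
  h 1 = 0 -> h 2 = 0 -> forall n, n != 0 -> h n = 0.
Proof.
move=> H h1 h2.
have hS (k : nat) : h (k%:Z + 2) = 0.
  elim: k => [|k IHk]; first by rewrite add0r.
  have := H (k%:Z + 2) 1 ltac:(lia) isT ltac:(lia).
  rewrite IHk h1 !mulr0 subr0 => /eqP; rewrite mulf_eq0 intr_eq0.
  case/orP=> [|/eqP <-]; first lia.
  by congr h; lia.
have pos n : 0 < n -> h n = 0.
  move=> n0; have [->//|n1] := eqVneq n 1.
  by rewrite (_ : n = `|n - 2|%N%:Z + 2) ?hS //; lia.
move=> n n0; have [/pos//|n_le0] := ltP 0 n.
have := H n (1 - n) n0 ltac:(lia) ltac:(lia).
rewrite (_ : n + (1 - n) = 1) ?(pos (1 - n)) ?h1 ?mulr0 ?subr0; try lia.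
by move=> /esym/eqP; rewrite mulf_eq0 intr_eq0 (negPf n0) => /eqP.
Qed.

(** * Normal form of derivations *)

(** Inverts [[-, L_0]] off degree 0; in degree 0 the quotient is 0, as division by zero returns
    0. *)
Lemma thv_degree_antiderivative x :
  exists u, forall k, thv_coef k u = thv_coef k x / (thv_degree k)%:~R.
Proof.
rewrite (thv_basisE x).
elim/big_ind: _ => [|y z [u uE] [v vE]|j _].
- by exists 0 => k; rewrite thv_coef0 mul0r.
- by exists (u + v) => k; rewrite !thv_coefD uE vE mulrDl.
exists ((thv_coef j x / (thv_degree j)%:~R) *: e j) => k.
rewrite -/(thv_coef j x) !thv_coefZ thv_coef_basis.
by have [->|] := eqVneq j k; rewrite ?mulr0 ?mul0r // mulr1 mulr1.
Qed.

(** Choosing [u] with [[u, L_0]] equal to [D L_0] off degree 0 leaves [D0 L_0] in degree 0, that is,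
    [a L_0] plus a central element. Applying [D0] to [[e_j, L_0] = deg(j) e_j] then shows that
    [D0 e_j] is an eigenvector of [[-, L_0]], once [a = 0]. *)
Lemma thv_derivation_graded D : thv_derivation D ->
  exists u, forall j k, thv_degree j != 0 -> thv_degree k != thv_degree j ->
    thv_coef k (D (e j) - {[u, e j]}) = 0.
Proof.
move=> dD; have [u uE] := thv_degree_antiderivative (D (e (iL 0))).
exists u => j k j0 kj.
pose D0 x : thv F := D x - {[u, x]}.
have dD0 : thv_derivation D0 := thv_derivationB dD (thv_derivation_ad u).
have [w wE] : exists w, w = D0 (e (iL 0)) by exists (D0 (e (iL 0))).
pose a := thv_coef (iL 0) w.
have w0 i : thv_degree i != 0 -> thv_coef i w = 0.
  move=> i0; rewrite wE /D0 thv_coefD thv_coefN thv_coef_bracketL0 uE.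
  by rewrite mulrC divfK ?subrr // intr_eq0.
have bw x : {[x, w]} = a *: {[x, e (iL 0)]}.
  apply/eqP; rewrite -subr_eq0 -thv_bracketZr -thv_bracketNr -thv_bracketDr.
  rewrite thv_bracket_centralr // => n; last first.
    by move=> n0; rewrite !thv_coefE !thv_index_eqE mulr0 subr0 w0.
  rewrite !thv_coefE !thv_index_eqE; have [<-|n0] := eqVneq 0 n.
    by rewrite mulr1 subrr.
  by rewrite mulr0 subr0 w0 // eq_sym.
have jL0 : {[e j, e (iL 0)]} = (thv_degree j)%:~R *: e j.
  apply: thv_coefP => i; rewrite thv_coef_bracketL0 thv_coefZ !thv_coef_basis.
  by have [->|] := eqVneq j i; rewrite ?mulr0.
have key i : (thv_degree j)%:~R * thv_coef i (D0 (e j)) =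
    (thv_degree i)%:~R * thv_coef i (D0 (e j)) + a * ((thv_degree j)%:~R * (j == i)%:R).
  case: (dD0) => _ /(_ (e j) (e (iL 0))) => /(congr1 (thv_coef i)).
  rewrite -wE bw jL0 (thv_derivationZ _ _ dD0) thv_coefD !thv_coefZ.
  by rewrite thv_coef_bracketL0 thv_coef_basis.
(* In the coefficient of [e j] itself the two [D0] terms cancel, leaving [a] times the nonzero
   degree. *)
have a0 : a = 0.
  have /eqP := key j; rewrite eqxx mulr1 -subr_eq0 opprD addrA subrr add0r.
  by rewrite oppr_eq0 mulf_eq0 intr_eq0 (negPf j0) orbF => /eqP.
have /eqP := key k; rewrite a0 mul0r addr0 -subr_eq0 -mulrBl mulf_eq0.
by rewrite subr_eq0 eqr_int eq_sym (negPf kj) => /eqP.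
Qed.

(* Only degrees [n != 0] matter, by [thv_derivation_eq0]; leaving out degree [0]
   spares the values of [D] on the centre. *)
Lemma thv_derivation_normal_form D : thv_derivation D ->
  exists u (al be ga : F),
  (forall n, n != 0 -> D (e (iL n)) = {[u, e (iL n)]} + (al + be * n%:~R) *: e (iI n))
  /\ (forall n, n != 0 -> D (e (iI n)) = {[u, e (iI n)]} + ga *: e (iI n)).
Proof.
move=> dD; have [u0 gr0] := thv_derivation_graded dD.
pose D0 x : thv F := D x - {[u0, x]}.
have dD0 : thv_derivation D0 := thv_derivationB dD (thv_derivation_ad u0).
have gr j k : thv_degree j != 0 -> thv_degree k != thv_degree j ->
  thv_coef k (D0 (e j)) = 0 by exact: gr0.
move: D0 dD0 gr (fun x => erefl _ : D0 x = D x - {[u0, x]}) {gr0}.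
move=> D0 dD0 gr D0E; case: (dD0) => _ D0M.
pose a n := thv_coef (iL n) (D0 (e (iL n))).
pose b n := thv_coef (iI n) (D0 (e (iL n))).
pose d n := thv_coef (iL n) (D0 (e (iI n))).
pose c n := thv_coef (iI n) (D0 (e (iI n))).
have addK n m : n + m - m = n by rewrite addrK.
have addK' n m : n + m - n = m by rewrite addrC addKr.
have LL n m : {[e (iL n), e (iL m)]} = (n - m)%:~R *: e (iL (n + m))
    + (n == - m)%:R *: (((n ^+ 3 - n)%:~R / 12%:R) *: e iCL).
  exact: thv_bracket_basisE.
have IL n m : {[e (iI n), e (iL m)]} = - ((- n%:~R) *: e (iI (m + n))
    + (m == - n)%:R *: ((m ^+ 2 + m)%:~R *: e iCLI)).
  exact: thv_bracket_basisE.
have LL0 n m : n + m != 0 -> {[e (iL n), e (iL m)]} = (n - m)%:~R *: e (iL (n + m)).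
  by move=> nm; rewrite LL -addr_eq0 (negPf nm) scale0r addr0.
have IL0 n m : n + m != 0 -> {[e (iI n), e (iL m)]} = n%:~R *: e (iI (n + m)).
  by move=> nm; rewrite IL -addr_eq0 (addrC m n) (negPf nm) scale0r addr0 scaleNr opprK.
have D0LL n m : n + m != 0 -> (n - m)%:~R *: D0 (e (iL (n + m))) =
    {[D0 (e (iL n)), e (iL m)]} - {[D0 (e (iL m)), e (iL n)]}.
  move=> nm; rewrite -(thv_derivationZ _ _ dD0) -LL0 // D0M; congr (_ + _).
  exact: thv_bracketC.
have D0IL n m : n + m != 0 -> n%:~R *: D0 (e (iI (n + m))) =
    {[D0 (e (iI n)), e (iL m)]} - {[D0 (e (iL m)), e (iI n)]}.
  move=> nm; rewrite -(thv_derivationZ _ _ dD0) -IL0 // D0M; congr (_ + _).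
  exact: thv_bracketC.
have aE n m : n + m != 0 -> (n - m)%:~R * a (n + m) = (n - m)%:~R * (a n + a m).
  move=> /D0LL/(congr1 (thv_coef (iL (n + m)))).
  rewrite thv_coefZ thv_coefD thv_coefN !thv_coef_bracketLL addK addK' => ->.
  by rewrite -/(a n) -/(a m) mulrDr -mulNr -rmorphN opprB.
have bE n m : n + m != 0 -> (n - m)%:~R * b (n + m) = n%:~R * b n - m%:~R * b m.
  move=> /D0LL/(congr1 (thv_coef (iI (n + m)))).
  by rewrite thv_coefZ thv_coefD thv_coefN !thv_coef_bracketIL addK addK'.
have dE n m : n + m != 0 -> n%:~R * d (n + m) = (n - m)%:~R * d n.
  move=> /D0IL/(congr1 (thv_coef (iL (n + m)))).
  rewrite thv_coefZ thv_coefD thv_coefN thv_coef_bracketLL thv_coef_bracketLI.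
  by rewrite subr0 addK.
have cE n m : n + m != 0 -> n != 0 -> c (n + m) = c n + a m.
  move=> /D0IL/(congr1 (thv_coef (iI (n + m)))).
  rewrite thv_coefZ thv_coefD thv_coefN thv_coef_bracketIL thv_coef_bracketII.
  rewrite addK addK' => E n0; apply: (@mulfI _ n%:~R); first by rewrite intr_eq0.
  by rewrite E mulrDr rmorphN mulNr opprK.
have aP n : n != 0 -> a n = n%:~R * a 1.
  move=> n0; apply/eqP; rewrite -subr_eq0; apply/eqP; move: n n0.
  apply: add_constant_vanish => [n m n0 m0 nm|]; last by rewrite mul1r subrr.
  by rewrite mulrBr aE // rmorphD /=; ring.
(* The affine function through the values of [b] at 1 and 2. *)
pose al := 2 * b 1 - b 2; pose be := b 2 - b 1.
have bP n : n != 0 -> b n = al + be * n%:~R.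
  move=> n0; apply/eqP; rewrite -subr_eq0; apply/eqP; move: n n0.
  apply: cocycle_vanish => [n m n0 m0 nm||]; last 2 first.
  - by rewrite /al /be; ring.
  - by rewrite /al /be; ring.
  by rewrite mulrBr bE // !rmorphD /= rmorphN; ring.
(* At [n = m = 1] the right-hand factor [n - m] is zero; [n = 2] then spreads this to every nonzero
   degree. *)
have d2 : d 2 = 0.
  have /eqP := dE 1 1 isT; rewrite subrr mul0r mul1r => /eqP; exact.
have dP n : n != 0 -> d n = 0.
  move=> n0; have := dE 2 (n - 2) ltac:(lia).
  rewrite d2 mulr0 addrC subrK => /eqP; rewrite mulf_eq0 intr_eq0 => /eqP; exact.
have cP n : n != 0 -> c n = c 1 + (n%:~R - 1) * a 1.
  move=> n0; have [->|n1] := eqVneq n 1; first by rewrite subrr mul0r addr0.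
  have := cE 1 (n - 1) ltac:(lia) isT; rewrite addrC subrK => ->.
  by rewrite aP ?subr_eq0 // rmorphB.
(* The part [n * a 1] of [a n] and [c n] is inner, since [[- a 1 L_0, e_j] = a 1 * deg(j) e_j]; what
   is left of [c n] is the constant [c 1 - a 1]. *)
exists (u0 - a 1 *: e (iL 0)), al, be, (c 1 - a 1).
have bu y : {[u0 - a 1 *: e (iL 0), y]} = {[u0, y]} + a 1 *: {[y, e (iL 0)]}.
  rewrite thv_bracketDl; congr (_ + _).
  by rewrite thv_bracketC thv_bracketNr thv_bracketZr opprK.
have adj x y z : D0 x = y + z -> D x = {[u0, x]} + y + z.
  by rewrite D0E -addrA => <-; rewrite addrC subrK.
split=> n n0.
- rewrite bu; apply: adj; apply: thv_coefP => k.
  rewrite thv_coefD !thv_coefZ thv_coef_bracketL0 !thv_coef_basis.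
  have [kn|kn] := eqVneq (thv_degree k) n; last first.
    have N j : thv_degree j = n -> j == k = false.
      by move=> jn; apply: contraNF kn => /eqP <-; apply/eqP.
    by rewrite gr // (N (iL n)) // (N (iI n)) // !mulr0 addr0.
  case: k kn n0 => [m|m|||] /= <- n0; try by rewrite eqxx in n0.
  - by rewrite -/(a m) aP // eqxx mulr0 addr0 mulr1 mulrC.
  - by rewrite -/(b m) bP // eqxx !mulr0 add0r mulr1.
- rewrite bu; apply: adj; apply: thv_coefP => k.
  rewrite thv_coefD !thv_coefZ thv_coef_bracketL0 !thv_coef_basis.
  have [kn|kn] := eqVneq (thv_degree k) n; last first.
    have N j : thv_degree j = n -> j == k = false.
      by move=> jn; apply: contraNF kn => /eqP <-; apply/eqP.
    by rewrite gr // (N (iI n)) // !mulr0 addr0.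
  case: k kn n0 => [m|m|||] /= <- n0; try by rewrite eqxx in n0.
  - by rewrite -/(d m) dP // !mulr0 addr0.
  - by rewrite -/(c m) cP // eqxx !mulr1; ring.
Qed.

(** * Derivations killing a probe *)

Lemma thv_coef_bounded x :
  exists B : int, forall k, B < `|thv_degree k| -> thv_coef k x = 0.
Proof.
rewrite (thv_basisE x); elim/big_ind: _ => [|y z [B yB] [C zC]|j _].
- by exists 0 => k _; rewrite thv_coef0.
- exists (Num.max B C) => k; rewrite gt_max => /andP[Bk Ck].
  by rewrite thv_coefD yB ?zC ?addr0.
exists `|thv_degree j| => k jk; rewrite thv_coefZ thv_coef_basis.
by have [jk'|] := eqVneq j k; rewrite ?mulr0 //; move: jk; rewrite jk' ltxx.
Qed.

(** Downward induction in steps of 2; finite support supplies the base, and [J] bounds the range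
    where the recursion is available. *)
Lemma vanish_descend (h : int -> F) (J B : int) :
  (forall n, B < n -> h n = 0) -> (forall n, J <= n -> h (n + 2) = 0 -> h n = 0) ->
  forall n, J <= n -> h n = 0.
Proof.
move=> hB hJ; suff H (k : nat) n : J <= n -> B < n + k.*2%:Z -> h n = 0.
  by move=> n Jn; apply: (H `|B - n|%N.+1) => //; lia.
elim: k n => [|k IHk] n Jn Bn; first by apply: hB; lia.
by apply: hJ => //; apply: IHk; lia.
Qed.

Lemma vanish_ascend (h : int -> F) (J B : int) :
  (forall n, n < B -> h n = 0) -> (forall n, n <= J -> h (n - 2) = 0 -> h n = 0) ->
  forall n, n <= J -> h n = 0.
Proof.
move=> hB hJ n nJ; rewrite -[n]opprK.
apply: (@vanish_descend (fun m => h (- m)) (- J) (- B)); last by rewrite lerN2.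
- by move=> m Bm; apply: hB; rewrite ltrNl.
- by move=> m Jm; rewrite opprD; apply: hJ; rewrite lerNl.
Qed.

(* [L_p - L_(p+2)] corresponds to the vector field [t^(p+1) (1 - t^2) d/dt]; as
   [1 - t^2] has two roots, both odd and even degrees obstruct a nonzero outer
   part, and [I_(p+1)] sits in the parity opposite to that of the [L]-part. *)
Definition thv_probe p : thv F :=
  e (iL p) + (- 1) *: e (iL (p + 2)) + e (iI (p + 1)).

Lemma thv_probe_degree p k :
  thv_coef k (thv_probe p) != 0 -> p <= thv_degree k <= p + 2.
Proof.
rewrite !thv_coefD thv_coefZ !thv_coef_basis.
have [<- _ /=|_] := eqVneq (iL p); first lia.
have [<- _ /=|_] := eqVneq (iL (p + 2)); first lia.
have [<- _ /=|_] := eqVneq (iI (p + 1)); first lia.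
by rewrite mulr0 !addr0 eqxx.
Qed.

Lemma thv_coef_probeL p n :
  thv_coef (iL n) (thv_probe p) = (p == n)%:R - (p + 2 == n)%:R.
Proof. by rewrite !thv_coefD thv_coefZ !thv_coef_basis !thv_index_eqE addr0 mulN1r. Qed.

(** The vanishing of [u] at [L_p] normalizes [u] modulo the probe. Two-step recurrences read off
    from [D z_p = 0], together with finite support, then kill the [L]-part of [u], its noncentral
    [I]-part and the outer scalars. *)
Lemma thv_derivation_probe0 p D u (al be ga : F) :
  0 < p -> thv_derivation D -> D (thv_probe p) = 0 ->
  (forall n, n != 0 -> D (e (iL n)) = {[u, e (iL n)]} + (al + be * n%:~R) *: e (iI n)) ->
  (forall n, n != 0 -> D (e (iI n)) = {[u, e (iI n)]} + ga *: e (iI n)) ->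
  thv_coef (iL p) u = 0 -> forall x, D x = 0.
Proof.
move=> p0 dD Dp DL DI up.
have DpE k : thv_coef k (D (e (iL p))) - thv_coef k (D (e (iL (p + 2))))
    + thv_coef k (D (e (iI (p + 1)))) = 0.
  rewrite -[RHS](thv_coef0 k) -Dp /thv_probe !(thv_derivationD _ _ dD).
  by rewrite (thv_derivationZ _ _ dD) !thv_coefD thv_coefZ mulN1r.
have [pn0 pn1 pn2] : [/\ p != 0, p + 1 != 0 & p + 2 != 0] by split; lia.
have DLL n (k : int) : n != 0 -> thv_coef (iL k) (D (e (iL n))) =
    (k - n - n)%:~R * thv_coef (iL (k - n)) u.
  move=> n0; rewrite DL // thv_coefD thv_coefZ thv_coef_basis thv_index_eqE.
  by rewrite mulr0 addr0 thv_coef_bracketLL.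
have DLI n (k : int) : n != 0 -> thv_coef (iI k) (D (e (iL n))) =
    (k - n)%:~R * thv_coef (iI (k - n)) u + (al + be * n%:~R) * (n == k)%:R.
  move=> n0; rewrite DL // thv_coefD thv_coefZ thv_coef_basis thv_index_eqE.
  by rewrite thv_coef_bracketIL.
have DIL n (k : int) : n != 0 -> thv_coef (iL k) (D (e (iI n))) = 0.
  move=> n0; rewrite DI // thv_coefD thv_coefZ thv_coef_basis thv_index_eqE.
  by rewrite mulr0 addr0 thv_coef_bracketLI.
have DII n (k : int) : n != 0 -> thv_coef (iI k) (D (e (iI n))) =
    (- n)%:~R * thv_coef (iL (k - n)) u + ga * (n == k)%:R.
  move=> n0; rewrite DI // thv_coefD thv_coefZ thv_coef_basis thv_index_eqE.
  by rewrite thv_coef_bracketII.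
have [B uB] := thv_coef_bounded u.
have fE (j : int) : (j + 2 - p)%:~R * thv_coef (iL (j + 2)) u =
    (j - p - 2)%:~R * thv_coef (iL j) u.
  have := DpE (iL (j + p + 2)).
  rewrite (DLL p) // (DLL (p + 2)) // (DIL (p + 1)) // addr0.
  rewrite (_ : j + p + 2 - p = j + 2) 1?(_ : j + p + 2 - (p + 2) = j); try ring.
  rewrite (_ : j - (p + 2) = j - p - 2); last by ring.
  by move/eqP; rewrite subr_eq0 => /eqP.
have f0 (j : int) : thv_coef (iL j) u = 0.
  apply: (@vanish_descend (fun n => thv_coef (iL n) u) j B) => // n.
    by move=> Bn; apply: uB => /=; lia.
  move=> _ /= n2; have [nE|nE] := eqVneq n (p + 2); last first.
    have /esym/eqP := fE n; rewrite n2 mulr0 mulf_eq0 intr_eq0 => /orP[|/eqP //].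
    lia.
  have /eqP := fE p; rewrite up mulr0 mulf_eq0 intr_eq0 nE => /orP[|/eqP //].
  lia.
(* The factor [j] gives [h 0 = 0], so the central [I_0] does not interfere. In the recurrence [hE]
   the outer scalars enter only at [j = 0, 1, 2]; descending to 1 and ascending to -1 both avoid
   these places. *)
pose h (j : int) := j%:~R * thv_coef (iI j) u.
have hE (j : int) : h j - h (j - 2) + (al + be * p%:~R) * (j == 0)%:R
    - (al + be * (p + 2)%:~R) * (j == 2)%:R + ga * (j == 1)%:R = 0.
  have := DpE (iI (j + p)).
  rewrite (DLI p) // (DLI (p + 2)) // (DII (p + 1)) // f0 mulr0 add0r.
  rewrite (_ : j + p - p = j) 1?(_ : j + p - (p + 2) = j - 2); try ring.
  rewrite (_ : (p == j + p) = (j == 0)) 1?(_ : (p + 2 == j + p) = (j == 2)); try lia.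
  rewrite (_ : (p + 1 == j + p) = (j == 1)); last lia.
  by rewrite -/(h j) -/(h (j - 2)) => <-; ring.
have hpos (j : int) : 1 <= j -> h j = 0.
  apply: (@vanish_descend h 1 B) => n.
    by move=> Bn; rewrite /h uB ?mulr0 //=; lia.
  move=> n1 hn; have := hE (n + 2); rewrite hn addrK.
  rewrite (_ : (n + 2 == 0) = false) 1?(_ : (n + 2 == 2) = false); try lia.
  rewrite (_ : (n + 2 == 1) = false); last lia.
  by rewrite !mulr0 !addr0 subr0 sub0r => /eqP; rewrite oppr_eq0 => /eqP.
have hneg (j : int) : j <= - 1 -> h j = 0.
  apply: (@vanish_ascend h (- 1) (- B)) => n.
    by move=> Bn; rewrite /h uB ?mulr0 //=; lia.
  move=> n1 hn; have := hE n; rewrite hn.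
  rewrite (_ : (n == 0) = false) 1?(_ : (n == 2) = false); try lia.
  rewrite (_ : (n == 1) = false); last lia.
  by rewrite !mulr0 !addr0 !subr0.
have h0 (j : int) : h j = 0.
  have [->|j0] := eqVneq j 0; first by rewrite /h mul0r.
  by case: (ltP 0 j) => ?; [apply: hpos|apply: hneg]; lia.
(* With [h = 0], the three exceptional indices isolate the outer scalars; the affine function
   vanishes at both [p] and [p + 2], hence is zero. *)
have E0 : al + be * p%:~R = 0.
  by have := hE 0; rewrite !h0 subr0 add0r !mulr0 mulr1 addr0 subr0.
have E1 : ga = 0.
  by have := hE 1; rewrite !h0 !mulr0 mulr1 !subr0 !add0r.
have E2 : al + be * (p + 2)%:~R = 0.
  have /eqP := hE 2; rewrite !h0 subr0 add0r !mulr0 mulr1 add0r addr0.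
  by rewrite oppr_eq0 => /eqP.
have be0 : be = 0.
  have : be * (p + 2)%:~R - be * p%:~R = 0.
    by rewrite -[RHS](subrr 0) -{1}E2 -E0; ring.
  rewrite -mulrBr -rmorphB => /eqP; rewrite mulf_eq0 intr_eq0.
  by case/orP => [/eqP //|]; lia.
have al0 : al = 0 by move: E0; rewrite be0 mul0r addr0.
have uC x : {[u, x]} = 0.
  rewrite thv_bracketC thv_bracket_centralr ?oppr0 // => n n0.
  by have /eqP := h0 n; rewrite mulf_eq0 intr_eq0 (negPf n0) => /eqP.
apply: (thv_derivation_eq0 dD) => n n0.
- by rewrite DL // uC al0 be0 mul0r addr0 scale0r addr0.
- by rewrite DI // uC E1 scale0r addr0.
Qed.

(** Subtracting a multiple of [ad z_p] preserves [D z_p = 0] and the outer scalars; since [z_p] has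
    coefficient 1 at [L_p], a suitable multiple achieves the normalization. *)
Lemma thv_derivation_probe p D :
  0 < p -> thv_derivation D -> D (thv_probe p) = 0 ->
  exists c : F, forall x, D x = c *: {[thv_probe p, x]}.
Proof.
move=> p0 dD Dp; have [u [al [be [ga [DL DI]]]]] := thv_derivation_normal_form dD.
exists (thv_coef (iL p) u) => x.
pose v := u - thv_coef (iL p) u *: thv_probe p.
have vE y : {[v, y]} = {[u, y]} - thv_coef (iL p) u *: {[thv_probe p, y]}.
  by rewrite thv_bracketDl -scaleNr thv_bracketZl scaleNr.
have dD' := thv_derivationB dD (thv_derivation_ad (thv_coef (iL p) u *: thv_probe p)).
apply/eqP; rewrite -subr_eq0 -thv_bracketZl; apply/eqP.
apply: (@thv_derivation_probe0 p _ v al be ga p0 dD').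
- by rewrite Dp thv_bracketZl thv_bracketxx scaler0 subrr.
- by move=> n n0; rewrite DL // vE thv_bracketZl addrAC.
- by move=> n n0; rewrite DI // vE thv_bracketZl addrAC.
rewrite thv_coefD thv_coefN thv_coefZ thv_coef_probeL eqxx.
by rewrite (_ : (p + 2 == p) = false) ?subr0 ?mulr1 ?subrr //; lia.
Qed.

(** * From 2-local derivations to derivations *)

Lemma thv_2local_is_derivation (Delta : thv F -> thv F) :
  thv_2local_derivation Delta -> thv_derivation Delta.
Proof.
move=> hD.
have [D [dD D1 D2]] := hD (thv_probe 1) (thv_probe 2).
(* The derivation attached to the pair [z_p, x] differs from [D] by a derivation killing [z_p]. *)
have agree p x : 0 < p -> D (thv_probe p) = Delta (thv_probe p) ->
    exists c : F, Delta x - D x = c *: {[thv_probe p, x]}.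
  move=> p0 Dp; have [D' [dD' D'p D'x]] := hD (thv_probe p) x.
  have dB := thv_derivationB dD' dD.
  have [|c cE] := thv_derivation_probe p0 dB; first by rewrite D'p Dp subrr.
  by exists c; rewrite -D'x; apply: cE.
have probe N : 2 < N -> D (thv_probe N) = Delta (thv_probe N).
  move=> N2; have [c cE] := agree 1 (thv_probe N) isT D1.
  have [c' c'E] := agree 2 (thv_probe N) isT D2.
  have c'0 : c' = 0.
    (* [[z_1, z_N]] stops at degree [N + 5], whereas [[z_2, z_N]] has leading term [[L_4, L_(N+2)] =
       (2 - N) L_(N+6)], nonzero for [N > 2]. *)
    have : c' * thv_coef (iL (N + 6)) {[thv_probe 2, thv_probe N]} = 0.
      rewrite -thv_coefZ -c'E cE thv_coefZ thv_bracket_degree ?mulr0 //.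
      by move=> i j /thv_probe_degree + /thv_probe_degree /=; lia.
    rewrite {2}/thv_probe !thv_bracketDr thv_bracketZr.
    rewrite thv_coefD thv_coefD thv_coefZ (thv_coef_bracketLL _ N).
    rewrite (thv_coef_bracketLL _ (N + 2)) (thv_coef_bracketLI _ (N + 1)).
    rewrite !thv_coef_probeL => /eqP; rewrite mulf_eq0 => /orP[/eqP //|].
    rewrite (_ : (2 == N + 6 - N) = false); last lia.
    rewrite (_ : (2 + 2 == N + 6 - N) = false); last lia.
    rewrite (_ : (2 == N + 6 - (N + 2)) = false); last lia.
    rewrite (_ : (2 + 2 == N + 6 - (N + 2)) = true); last lia.
    rewrite subr0 mulr0 add0r addr0 sub0r mulN1r mulrN1 opprK intr_eq0; lia.
  by apply/eqP; rewrite eq_sym -subr_eq0 c'E c'0 scale0r.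
suff DE x : Delta x = D x.
  split=> [a x y|x y]; rewrite !DE; first by case: dD => ->.
  by case: dD => _ ->.
apply/eqP; rewrite -subr_eq0; apply/eqP.
have [B xB] := thv_coef_bounded x.
(* [[z_1, x]] lives in degrees at most [B + 3] and [[z_N, x]] in degrees at least [N - B], which is
   at least [B + 4]. *)
pose N : int := `|B| + `|B| + 4.
have [c cE] := agree 1 x isT D1.
have [c' c'E] : exists c : F, Delta x - D x = c *: {[thv_probe N, x]}.
  by apply: agree; [lia|apply: probe; lia].
have xb j : thv_coef j x != 0 -> `|thv_degree j| <= B.
  by apply: contraNT; rewrite -ltNge => /xB ->.
apply: thv_coefP => k; rewrite thv_coef0.
have [k3|k3] := leP (thv_degree k) (3 + B).
  rewrite c'E thv_coefZ thv_bracket_degree ?mulr0 // => i j.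
  by move=> /thv_probe_degree + /xb; lia.
rewrite cE thv_coefZ thv_bracket_degree ?mulr0 // => i j.
by move=> /thv_probe_degree + /xb; lia.
Qed.

End TwistedHeisenbergVirasoro.

Theorem theorem3p6 (R : realType) (Delta : thv R[i] -> thv R[i])
  (hDelta : thv_2local_derivation Delta) : thv_derivation Delta.
Proof. exact: thv_2local_is_derivation. Qed.
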